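(* Let $T$ be a truss, let $f,g\colon G\to H$ be a pair of parallel morphisms of heaps of $T$-modules, and let $e\in H$. Let $[[f,g]]_e$ denote the sub-heap of $T$-modules of $H$ generated by $e$ and the elements $[f(x),g(x),e]$ for all $x\in G$. Then the coequalizer of $(f,g)$ in the category of heaps of $T$-modules can be realised as $H/[[f,g]]_e$ with the canonical projection $H\to H/[[f,g]]_e$.
   Context: An abelian heap is a (possibly empty) set $H$ with a ternary operation $[-,-,-]$ satisfying $[a,b,[c,d,e]]=[[a,b,c],d,e]$, $[a,b,b]=a=[b,b,a]$ and $[a,b,c]=[c,b,a]$; heap morphisms preserve the bracket. A truss is an abelian heap $T$ with an associative binary multiplication such that $t[s,s',s'']=[ts,ts',ts'']$ and $[s,s',s'']t=[st,s't,s''t]$. A left $T$-module is an abelian heap $M$ with an action $\cdot\colon T\times M\to M$ with $t\cdot(t'\cdot m)=(tt')\cdot m$, $[t,t',t'']\cdot m=[t\cdot m,t'\cdot m,t''\cdot m]$, $t\cdot[m,n,e]=[t\cdot m,t\cdot n,t\cdot e]$. A heap of $T$-modules is an abelian heap $M$ (possibly empty) with an operation $T\times M\times M\to M$, $(t,m,n)\mapsto t\triangleright_m n$, such that for each $m\in M$ the map $(t,n)\mapsto t\triangleright_m n$ makes $M$ a left $T$-module, and $t\triangleright_m n=[t\triangleright_e n,t\triangleright_e m,m]$ for all $m,n,e\in M$, $t\in T$. Morphisms are heap morphisms $f$ with $f(t\triangleright_m n)=t\triangleright_{f(m)}f(n)$. A sub-heap of $T$-modules is a subset closed under $[-,-,-]$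 and under $\triangleright$. For a non-empty sub-heap of $T$-modules $N\subseteq M$, the relation $a\sim_N b\iff [a,b,s]\in N$ for all $s\in N$ is a congruence on the heap of $T$-modules $M$, and $M/N$ denotes the quotient heap of $T$-modules $M/{\sim_N}$ with operations induced from $M$. *)

(* Defs.v *)
From HB Require Import structures.
From mathcomp Require Import all_boot.
From mathcomp Require Import boolp classical_sets.

Set Implicit Arguments.
Unset Strict Implicit.
Unset Printing Implicit Defensive.

Local Open Scope classical_set_scope.
Local Open Scope quotient_scope.

Declare Scope heap_scope.
Delimit Scope heap_scope with heap.
Local Open Scope heap_scope.

Reserved Notation "'[' 'heap' a , b , c ']'"
  (at level 0, a, b, c at level 99, format "[ 'heap'  a ,  b ,  c ]").
Reserved Notation "t '|>[' m ']' n"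
  (at level 40, m at level 99, n at next level, format "t  |>[ m ]  n").

(* Carriers are plain types, so that the empty heap is allowed. *)
HB.mixin Record isAbelianHeap (H : Type) := {
  heap_op : H -> H -> H -> H;
  heapA : forall a b c d e : H,
    heap_op a b (heap_op c d e) = heap_op (heap_op a b c) d e;
  heapKr : forall a b : H, heap_op a b b = a;
  heapKl : forall a b : H, heap_op b b a = a;
  heapC : forall a b c : H, heap_op a b c = heap_op c b a
}.

#[short(type="abelianHeapType")]
HB.structure Definition AbelianHeap := { H of isAbelianHeap H }.

Notation "'[' 'heap' a , b , c ']'" := (heap_op a b c) : heap_scope.

HB.mixin Record isTruss (T : Type) of AbelianHeap T := {
  truss_mul : T -> T -> T;
  truss_mulA : associative truss_mul;
  truss_mul_heapr : forall t s s' s'' : T,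
    truss_mul t [heap s, s', s'']
    = [heap truss_mul t s, truss_mul t s', truss_mul t s''];
  truss_mul_heapl : forall t s s' s'' : T,
    truss_mul [heap s, s', s''] t
    = [heap truss_mul s t, truss_mul s' t, truss_mul s'' t]
}.

#[short(type="trussType")]
HB.structure Definition Truss := { T of AbelianHeap T & isTruss T }.

Record left_module_action (T : trussType) (M : abelianHeapType)
    (act : T -> M -> M) : Prop := {
  lmod_actA : forall (t t' : T) (m : M),
    act t (act t' m) = act (truss_mul t t') m;
  lmod_act_heapl : forall (t t' t'' : T) (m : M),
    act [heap t, t', t''] m = [heap act t m, act t' m, act t'' m];
  lmod_act_heapr : forall (t : T) (m n e : M),
    act t [heap m, n, e] = [heap act t m, act t n, act t e]
}.

HB.mixin Record isHeapOfModules (T : trussType) (M : Type)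
    of AbelianHeap M := {
  hmod_act : T -> M -> M -> M;
  hmod_module : forall m : M, left_module_action (fun t n => hmod_act t m n);
  hmod_base : forall (t : T) (m n e : M),
    hmod_act t m n = [heap hmod_act t e n, hmod_act t e m, m]
}.

#[short(type="heapOfModulesType")]
HB.structure Definition HeapOfModules (T : trussType) :=
  { M of AbelianHeap M & isHeapOfModules T M }.

Notation "t '|>[' m ']' n" := (hmod_act t m n) : heap_scope.

HB.mixin Record isHeapOfModulesMorphism (T : trussType)
    (G H : heapOfModulesType T) (f : G -> H) := {
  hmor_heap : forall a b c : G,
    f [heap a, b, c] = [heap f a, f b, f c];
  hmor_act : forall (t : T) (m n : G),
    f (t |>[m] n) = t |>[f m] f n
}.

#[short(type="heapOfModulesMorphism")]
HB.structure Definition HeapOfModulesMorphism (T : trussType)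
    (G H : heapOfModulesType T) :=
  { f of @isHeapOfModulesMorphism T G H f }.

Definition is_subheap (T : trussType) (M : heapOfModulesType T)
    (N : set M) : Prop :=
  (forall a b c : M, N a -> N b -> N c -> N [heap a, b, c]) /\
  (forall (t : T) (m n : M), N m -> N n -> N (t |>[m] n)).

Record nesubheap (T : trussType) (M : heapOfModulesType T) := NESubheap {
  nesubheap_set :> set M;
  nesubheap_closed : is_subheap nesubheap_set;
  nesubheap_nonempty : nesubheap_set !=set0
}.

Definition generated_subheap (T : trussType) (M : heapOfModulesType T)
    (X : set M) : set M :=
  smallest (@is_subheap T M) X.

Definition subheap_rel (T : trussType) (M : heapOfModulesType T)
    (N : set M) (a b : M) : Prop :=
  forall s : M, N s -> N [heap a, b, s].

Section HeapTheory.
Variable H : abelianHeapType.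
Implicit Types a b c d e x : H.

Lemma heapACr x a b c d :
  [heap [heap x, a, b], c, d] = [heap [heap x, a, d], c, b].
Proof. by rewrite -[LHS]heapA -[RHS]heapA (heapC b). Qed.

Lemma heapCm a b c d e :
  [heap a, [heap b, c, d], e] = [heap [heap a, d, c], b, e].
Proof.
rewrite -[e in RHS](heapKl _ [heap b, c, d]) [in RHS]heapA.
by congr heap_op; rewrite heapA heapKr -heapA heapKl heapKr.
Qed.

Lemma heapACm x a b c d :
  [heap [heap x, a, b], c, d] = [heap [heap x, c, b], a, d].
Proof. by rewrite -!heapCm (heapC c). Qed.

Lemma heap_interchange a1 a2 a3 b1 b2 b3 c1 c2 c3 :
  [heap [heap a1, a2, a3], [heap b1, b2, b3], [heap c1, c2, c3]]
  = [heap [heap a1, b1, c1], [heap a2, b2, c2], [heap a3, b3, c3]].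
Proof.
rewrite !heapCm !heapA.
rewrite (heapACr _ a2 a3 b3) (heapACr _ b3 a3 b1) (heapACr _ a2 b2 b3).
rewrite (heapACm _ b3 b2 b1) (heapACm _ b3 a3 c2) (heapACm _ a2 c1 b1).
by rewrite (heapACm _ a2 b2 c2).
Qed.

End HeapTheory.

Section Quotient.
Variables (T : trussType) (M : heapOfModulesType T).

Lemma generated_subheap_closed (X : set M) : is_subheap (generated_subheap X).
Proof.
split=> [a b c Xa Xb Xc|t m n Xm Xn] A [closedA XA].
  by apply: closedA.1; [apply: Xa|apply: Xb|apply: Xc].
by apply: closedA.2; [apply: Xm|apply: Xn].
Qed.

Lemma hmod_actxx (t : T) (m : M) : t |>[m] m = m.
Proof. by rewrite (hmod_base t m m m) heapKl. Qed.

Variable N : nesubheap M.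

Lemma subheap_rel_refl a : subheap_rel N a a.
Proof. by move=> s Ns; rewrite heapKl. Qed.

Lemma subheap_rel_sym a b : subheap_rel N a b -> subheap_rel N b a.
Proof.
move=> ab s Ns; have -> : [heap b, a, s] = [heap s, [heap a, b, s], s].
  by rewrite heapCm heapKl.
by apply: (nesubheap_closed N).1 => //; apply: ab.
Qed.

Lemma subheap_rel_trans b a c :
  subheap_rel N a b -> subheap_rel N b c -> subheap_rel N a c.
Proof.
move=> ab bc s Ns.
have -> : [heap a, c, s] = [heap [heap a, b, s], s, [heap b, c, s]].
  by rewrite heapA -(heapA a b) heapKl heapKr.
by apply: (nesubheap_closed N).1 => //; [apply: ab|apply: bc].
Qed.

Lemma subheap_rel_heap a a' b b' c c' :
  subheap_rel N a a' -> subheap_rel N b b' -> subheap_rel N c c' ->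
  subheap_rel N [heap a, b, c] [heap a', b', c'].
Proof.
move=> aa' bb' cc' s Ns; rewrite -[s](heapKr s s) heap_interchange.
by apply: (nesubheap_closed N).1; [apply: aa'|apply: bb'|apply: cc'].
Qed.

Lemma subheap_rel_act t m m' n n' :
  subheap_rel N m m' -> subheap_rel N n n' ->
  subheap_rel N (t |>[m] n) (t |>[m'] n').
Proof.
have [s Ns] := nesubheap_nonempty N.
have act_s a a' : subheap_rel N a a' ->
    subheap_rel N (t |>[s] a) (t |>[s] a').
  move=> aa' u Nu; have NCl := nesubheap_closed N.
  have -> : [heap t |>[s] a, t |>[s] a', u] =
      [heap t |>[s] [heap a, a', s], s, u].
    by rewrite (lmod_act_heapr (hmod_module s)) hmod_actxx -heapA heapKl.
  by apply: NCl.1 => //; apply: NCl.2 => //; apply: aa'.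
move=> mm' nn'; rewrite (hmod_base t m n s) (hmod_base t m' n' s).
by apply: subheap_rel_heap => //; apply: act_s.
Qed.

(* [{classic M}] supplies the choice structure required by [{eq_quot _}]. *)
Definition subheap_relb (a b : {classic M}) : bool := `[< subheap_rel N a b >].

Lemma subheap_relb_refl : reflexive subheap_relb.
Proof. by move=> a; apply/asboolP/subheap_rel_refl. Qed.

Lemma subheap_relb_sym : symmetric subheap_relb.
Proof.
by move=> a b; apply/asboolP/asboolP; apply: subheap_rel_sym.
Qed.

Lemma subheap_relb_trans : transitive subheap_relb.
Proof.
by move=> b a c /asboolP ab /asboolP bc; apply/asboolP/(subheap_rel_trans ab).
Qed.

Canonical subheap_equiv :=
  EquivRel subheap_relb subheap_relb_refl subheap_relb_sym subheap_relb_trans.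

Definition hmod_quot : Type := {eq_quot subheap_equiv}.

Definition hmod_proj (a : M) : hmod_quot := \pi_({eq_quot subheap_equiv}) a.

Definition hmod_repr (x : hmod_quot) : M :=
  repr (x : {eq_quot subheap_equiv}).

Lemma hmod_reprK x : hmod_proj (hmod_repr x) = x.
Proof. exact: (reprK (x : {eq_quot subheap_equiv})). Qed.

Lemma hmod_projP a b : hmod_proj a = hmod_proj b <-> subheap_rel N a b.
Proof. by split=> [/eqmodP/asboolP //|ab]; apply/eqmodP/asboolP. Qed.

Lemma hmod_repr_proj a : subheap_rel N (hmod_repr (hmod_proj a)) a.
Proof. by apply/hmod_projP; rewrite hmod_reprK. Qed.

Definition quot_heap (x y z : hmod_quot) : hmod_quot :=
  hmod_proj [heap hmod_repr x, hmod_repr y, hmod_repr z].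

Definition quot_act (t : T) (x y : hmod_quot) : hmod_quot :=
  hmod_proj (t |>[hmod_repr x] hmod_repr y).

Lemma quot_heapE a b c :
  quot_heap (hmod_proj a) (hmod_proj b) (hmod_proj c)
  = hmod_proj [heap a, b, c].
Proof.
by apply/hmod_projP; apply: subheap_rel_heap; apply: hmod_repr_proj.
Qed.

Lemma quot_actE t a b :
  quot_act t (hmod_proj a) (hmod_proj b) = hmod_proj (t |>[a] b).
Proof. by apply/hmod_projP; apply: subheap_rel_act; apply: hmod_repr_proj. Qed.

Lemma hmod_quotW (P : hmod_quot -> Prop) :
  (forall a, P (hmod_proj a)) -> forall x, P x.
Proof. by move=> Pproj x; rewrite -[x]hmod_reprK. Qed.

Lemma quot_heapA x y z u v :
  quot_heap x y (quot_heap z u v) = quot_heap (quot_heap x y z) u v.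
Proof.
move: x y z u v; do 5![elim/hmod_quotW=> ?].
by rewrite !quot_heapE heapA.
Qed.

Lemma quot_heapKr x y : quot_heap x y y = x.
Proof. by move: x y; do 2![elim/hmod_quotW=> ?]; rewrite quot_heapE heapKr. Qed.

Lemma quot_heapKl x y : quot_heap y y x = x.
Proof. by move: x y; do 2![elim/hmod_quotW=> ?]; rewrite quot_heapE heapKl. Qed.

Lemma quot_heapC x y z : quot_heap x y z = quot_heap z y x.
Proof.
by move: x y z; do 3![elim/hmod_quotW=> ?]; rewrite !quot_heapE heapC.
Qed.

HB.instance Definition _ := isAbelianHeap.Build hmod_quot
  quot_heapA quot_heapKr quot_heapKl quot_heapC.

Lemma hmod_proj_heap a b c :
  hmod_proj [heap a, b, c] = [heap hmod_proj a, hmod_proj b, hmod_proj c].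
Proof. exact/esym/quot_heapE. Qed.

Lemma quot_module x : left_module_action (fun t y => quot_act t x y).
Proof.
elim/hmod_quotW: x => m; split=> t.
- move=> t'; elim/hmod_quotW=> n.
  by rewrite !quot_actE (lmod_actA (hmod_module m)).
- move=> t' t''; elim/hmod_quotW=> n.
  by rewrite !quot_actE -hmod_proj_heap (lmod_act_heapl (hmod_module m)).
- do 3![elim/hmod_quotW=> ?].
  rewrite -hmod_proj_heap !quot_actE -hmod_proj_heap.
  by rewrite (lmod_act_heapr (hmod_module m)).
Qed.

Lemma quot_base t x y z :
  quot_act t x y = [heap quot_act t z y, quot_act t z x, x].
Proof.
move: x y z; do 3![elim/hmod_quotW=> ?].
by rewrite !quot_actE -hmod_proj_heap -hmod_base.
Qed.

HB.instance Definition _ := isHeapOfModules.Build T hmod_quot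
  quot_module quot_base.

Lemma hmod_proj_act t m n :
  hmod_proj (t |>[m] n) = t |>[hmod_proj m] hmod_proj n.
Proof. exact/esym/quot_actE. Qed.

HB.instance Definition _ := isHeapOfModulesMorphism.Build T M hmod_quot
  hmod_proj hmod_proj_heap hmod_proj_act.

End Quotient.

Section Coequalizer.
Variables (T : trussType) (G H : heapOfModulesType T).
Variables f g : heapOfModulesMorphism G H.

Definition is_coequalizer (Q : heapOfModulesType T)
    (q : heapOfModulesMorphism H Q) : Prop :=
  q \o f =1 q \o g /\
  forall (K : heapOfModulesType T) (h : heapOfModulesMorphism H K),
    h \o f =1 h \o g ->
    exists k : heapOfModulesMorphism Q K,
      k \o q =1 h /\
      forall k' : heapOfModulesMorphism Q K, k' \o q =1 h -> k' =1 k.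

Variable e : H.

Definition coeq_subheap_set : set H :=
  generated_subheap (e |` range (fun x : G => [heap f x, g x, e])).

Lemma coeq_subheap_nonempty : coeq_subheap_set !=set0.
Proof. by exists e; apply: sub_gen_smallest; left. Qed.

Definition coeq_subheap : nesubheap H :=
  NESubheap (generated_subheap_closed _) coeq_subheap_nonempty.

End Coequalizer.

Arguments is_coequalizer {T G H} f g Q q.

(* Main.v *)
Require Import Defs.
From HB Require Import structures.
From mathcomp Require Import all_boot.
From mathcomp Require Import classical_sets.

(** The fibre of a morphism [h] through [h e] is a sub-heap of modules, and
    [h] coequalizes [f] and [g] exactly when this fibre contains every
    [[f x, g x, e]]. So a coequalizing [h] is constant on the sub-heap
    [[[f,g]]_e], hence constant on its congruence classes. *)

Set Implicit Arguments.
Unset Strict Implicit.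
Unset Printing Implicit Defensive.

Local Open Scope classical_set_scope.
Local Open Scope heap_scope.

(** Apply [[-, c, b]] to both sides of the hypothesis. *)
Lemma heap_eq (K : abelianHeapType) (a b c : K) : [heap a, b, c] = c -> a = b.
Proof. by move=> abc; rewrite -(heapKl b c) -{1}abc -heapA heapKl heapKr. Qed.

(** One base point suffices: [[a, b, u] = [[a, b, s], s, u]] moves the test from [s] to any other
    [u] in [N]. *)
Lemma subheap_relP (T : trussType) (M : heapOfModulesType T) (N : set M)
    (s a b : M) :
  is_subheap N -> N s -> N [heap a, b, s] -> subheap_rel N a b.
Proof.
move=> [N_heap _] Ns Nabs u Nu.
have -> : [heap a, b, u] = [heap [heap a, b, s], s, u].
  by rewrite -heapA heapKl.
exact: N_heap.
Qed.

(** Both operations are idempotent, [[c, c, c] = c] and [t |>[c] c = c], so singletons of [K] are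
    closed and so are their preimages. *)
Lemma is_subheap_fibre (T : trussType) (M K : heapOfModulesType T)
    (h : heapOfModulesMorphism M K) (c : K) : is_subheap [set a | h a = c].
Proof.
split=> [a b d /= ha hb hd|t m n /= hm hn].
  by rewrite hmor_heap ha hb hd heapKr.
by rewrite hmor_act hm hn hmod_actxx.
Qed.

Section QuotientFactorization.
Variables (T : trussType) (M K : heapOfModulesType T) (N : nesubheap M).
Variable h : heapOfModulesMorphism M K.
Hypothesis h_rel : forall a b, subheap_rel N a b -> h a = h b.

(** The compatibility proof is an argument so that the morphism instance depending on it can be
    attached to the term [quot_factor h_rel]. *)
Definition quot_factor of (forall a b, subheap_rel N a b -> h a = h b) :
  hmod_quot N -> K := fun x => h (hmod_repr x).

Local Notation k := (quot_factor h_rel).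

Lemma quot_factorE a : k (hmod_proj N a) = h a.
Proof. exact/h_rel/hmod_repr_proj. Qed.

Lemma quot_factor_heap x y z : k [heap x, y, z] = [heap k x, k y, k z].
Proof.
move: x y z; do 3![elim/hmod_quotW=> ?].
by rewrite -hmod_proj_heap !quot_factorE hmor_heap.
Qed.

Lemma quot_factor_act t x y : k (t |>[x] y) = t |>[k x] k y.
Proof.
move: x y; do 2![elim/hmod_quotW=> ?].
by rewrite -hmod_proj_act !quot_factorE hmor_act.
Qed.

HB.instance Definition _ := isHeapOfModulesMorphism.Build T (hmod_quot N) K
  (quot_factor h_rel) quot_factor_heap quot_factor_act.

End QuotientFactorization.

Lemma coeq_subheap_fibre (T : trussType) (G H K : heapOfModulesType T)
    (f g : heapOfModulesMorphism G H) (e : H)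
    (h : heapOfModulesMorphism H K) :
  h \o f =1 h \o g -> coeq_subheap_set f g e `<=` [set a | h a = h e].
Proof.
move=> hfg; apply: smallest_sub; first exact: is_subheap_fibre.
move=> _ [->//|[x _ <-]] /=.
by rewrite hmor_heap [h (f x)]hfg heapKl.
Qed.

Theorem proposition4p6 (T : trussType) (G H : heapOfModulesType T)
    (f g : heapOfModulesMorphism G H) (e : H) :
  is_coequalizer f g
    (hmod_quot (coeq_subheap f g e)) (hmod_proj (coeq_subheap f g e)).
Proof.
have Ne : coeq_subheap_set f g e e by apply: sub_gen_smallest; left.
split=> [x|K h hfg].
  (* With base point [e], the element to place in the sub-heap is the generator [[f x, g x, e]]. *)
  apply/hmod_projP; apply: (subheap_relP _ Ne).
    exact: generated_subheap_closed.
  by apply: sub_gen_smallest; right; exists x.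
have h_rel a b : subheap_rel (coeq_subheap f g e) a b -> h a = h b.
  (* Testing the relation at [e] gives [h [a, b, e] = h e], from which [heap_eq] cancels [h e]. *)
  move=> /(_ e Ne)/(coeq_subheap_fibre hfg) /=.
  by rewrite hmor_heap => /heap_eq.
exists (quot_factor h_rel); split=> [a|k' k'h]; first exact: quot_factorE.
by elim/hmod_quotW=> a; rewrite [RHS]quot_factorE -k'h.
Qed.
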